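(* Every Boolean elementary topos is CILC.
   Context: A geometric morphism $f : \mathcal{F} \to \mathcal{E}$ between elementary toposes is essential if the inverse image functor $f^*$ has a left adjoint, written $f_!$. It is locally connected if it is essential and for all morphisms $A \to B$ in $\mathcal{E}$ and $X \to f^*B$ in $\mathcal{F}$ the natural morphism $f_!(X \times_{f^*B} f^*A) \to f_!(X) \times_B A$ is an isomorphism (here $f_!(X)\to B$ is the adjoint transpose of $X \to f^*B$). An elementary topos $\mathcal{E}$ is CILC if every geometric morphism $f : \mathcal{F} \to \mathcal{E}$ (with $\mathcal{F}$ an elementary topos) such that $f^*$ is cartesian closed (i.e. preserves exponential objects) is locally connected. *)

(* Defs.v *)
(* Built on Rocq's Stdlib only.  Categories have hom-types with Leibniz equality.
   Limits, exponentials and subobject classifiers are given by their universal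
   properties and are only required to exist; nothing is chosen. *)
From Stdlib Require Import List FinFun.

Set Implicit Arguments.
Unset Strict Implicit.
Unset Printing Implicit Defensive.

Declare Scope cat_scope.
Delimit Scope cat_scope with cat.
Local Open Scope cat_scope.

(** * Categories, functors, adjunctions *)

Record Category : Type := {
  Obj :> Type;
  Hom : Obj -> Obj -> Type;
  idm : forall X, Hom X X;
  comp : forall X Y Z, Hom Y Z -> Hom X Y -> Hom X Z;
  comp_idl : forall X Y (f : Hom X Y), comp (idm Y) f = f;
  comp_idr : forall X Y (f : Hom X Y), comp f (idm X) = f;
  comp_assoc : forall W X Y Z (h : Hom Y Z) (g : Hom X Y) (f : Hom W X),
    comp h (comp g f) = comp (comp h g) f
}.

Arguments Hom {c} _ _.
Arguments idm {c} X.
Arguments comp {c X Y Z} _ _.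

Notation "g ∘ f" := (comp g f) (at level 40, left associativity) : cat_scope.

Record Functor (C D : Category) : Type := {
  fobj :> C -> D;
  fmap : forall X Y, Hom X Y -> Hom (fobj X) (fobj Y);
  fmap_id : forall X, fmap (idm X) = idm (fobj X);
  fmap_comp : forall X Y Z (g : Hom Y Z) (f : Hom X Y),
    fmap (g ∘ f) = fmap g ∘ fmap f
}.

Arguments fmap {C D} _ {X Y} _.

Lemma functor_comp_id (J C D : Category) (G : Functor C D) (F : Functor J C) (X : J) :
  fmap G (fmap F (idm X)) = idm (G (F X)).
Proof. rewrite fmap_id; apply fmap_id. Qed.

Lemma functor_comp_comp (J C D : Category) (G : Functor C D) (F : Functor J C)
    (X Y Z : J) (g : Hom Y Z) (f : Hom X Y) :
  fmap G (fmap F (g ∘ f)) = fmap G (fmap F g) ∘ fmap G (fmap F f).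
Proof. rewrite fmap_comp; apply fmap_comp. Qed.

Definition functor_comp (J C D : Category) (G : Functor C D) (F : Functor J C) :
    Functor J D :=
  {| fobj := fun X => G (F X);
     fmap := fun X Y f => fmap G (fmap F f);
     fmap_id := functor_comp_id G F;
     fmap_comp := functor_comp_comp G F |}.

Definition is_iso (C : Category) (X Y : C) (f : Hom X Y) : Prop :=
  exists g : Hom Y X, g ∘ f = idm X /\ f ∘ g = idm Y.

Definition is_mono (C : Category) (X Y : C) (f : Hom X Y) : Prop :=
  forall (W : C) (g h : Hom W X), f ∘ g = f ∘ h -> g = h.

(* [L] is left adjoint to [R]. *)
Record Adjunction (C D : Category) (L : Functor C D) (R : Functor D C) : Type := {
  to_right : forall (X : C) (Y : D), Hom (L X) Y -> Hom X (R Y);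
  to_left : forall (X : C) (Y : D), Hom X (R Y) -> Hom (L X) Y;
  to_left_right : forall X Y (g : Hom (L X) Y), to_left (to_right g) = g;
  to_right_left : forall X Y (g : Hom X (R Y)), to_right (to_left g) = g;
  to_right_natural : forall (X X' : C) (Y Y' : D)
      (f : Hom X' X) (g : Hom (L X) Y) (h : Hom Y Y'),
    to_right (h ∘ g ∘ fmap L f) = fmap R h ∘ to_right g ∘ f
}.

Arguments to_right {C D L R} _ {X Y} _.
Arguments to_left {C D L R} _ {X Y} _.

(** * Finite limits *)

Record Cone (J C : Category) (D : Functor J C) : Type := {
  vertex :> C;
  leg : forall j : J, Hom vertex (D j);
  leg_natural : forall (i j : J) (u : Hom i j), fmap D u ∘ leg i = leg j
}.

Definition is_limit (J C : Category) (D : Functor J C) (K : Cone D) : Prop :=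
  forall K' : Cone D, exists! h : Hom K' K, forall j, leg K j ∘ h = leg K' j.

Lemma map_cone_natural (J C C' : Category) (G : Functor C C') (D : Functor J C)
    (K : Cone D) (i j : J) (u : Hom i j) :
  fmap (functor_comp G D) u ∘ fmap G (leg K i) = fmap G (leg K j).
Proof. simpl; rewrite <- fmap_comp, leg_natural; reflexivity. Qed.

Definition map_cone (J C C' : Category) (G : Functor C C') (D : Functor J C)
    (K : Cone D) : Cone (functor_comp G D) :=
  {| vertex := G K;
     leg := (fun j => fmap G (leg K j)) : forall j, Hom (G K) (functor_comp G D j);
     leg_natural := map_cone_natural G K |}.

Definition finite_category (J : Category) : Prop :=
  Finite J /\ forall i j : J, Finite (Hom i j).

Definition has_finite_limits (C : Category) : Prop :=
  forall (J : Category) (D : Functor J C), finite_category J ->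
    exists K : Cone D, is_limit K.

Definition preserves_finite_limits (C C' : Category) (G : Functor C C') : Prop :=
  forall (J : Category) (D : Functor J C) (K : Cone D), finite_category J ->
    is_limit K -> is_limit (map_cone G K).

Definition is_terminal (C : Category) (T : C) : Prop :=
  forall X : C, exists! h : Hom X T, True.

Definition is_product (C : Category) (X Y P : C) (p : Hom P X) (q : Hom P Y) : Prop :=
  forall (W : C) (f : Hom W X) (g : Hom W Y),
    exists! h : Hom W P, p ∘ h = f /\ q ∘ h = g.

(* [p], [q] exhibit [P] as the pullback of [f] and [g]. *)
Definition is_pullback (C : Category) (X Y Z P : C)
    (f : Hom X Z) (g : Hom Y Z) (p : Hom P X) (q : Hom P Y) : Prop :=
  f ∘ p = g ∘ q /\
  forall (W : C) (u : Hom W X) (v : Hom W Y), f ∘ u = g ∘ v ->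
    exists! h : Hom W P, p ∘ h = u /\ q ∘ h = v.

(** * Exponentials *)

(* [E] is the exponential Y^X, where [p], [q] exhibit [P] as the product E × X
   and [ev : P -> Y] is the evaluation.  The morphism [k] below is h × X. *)
Definition is_exponential (C : Category) (X Y E P : C)
    (p : Hom P E) (q : Hom P X) (ev : Hom P Y) : Prop :=
  is_product p q /\
  forall (W Q : C) (p' : Hom Q W) (q' : Hom Q X) (g : Hom Q Y), is_product p' q' ->
    exists! h : Hom W E,
      exists k : Hom Q P, p ∘ k = h ∘ p' /\ q ∘ k = q' /\ ev ∘ k = g.

Definition has_exponentials (C : Category) : Prop :=
  forall X Y : C, exists (E P : C) (p : Hom P E) (q : Hom P X) (ev : Hom P Y),
    is_exponential p q ev.

Definition preserves_exponentials (C C' : Category) (G : Functor C C') : Prop :=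
  forall (X Y E P : C) (p : Hom P E) (q : Hom P X) (ev : Hom P Y),
    is_exponential p q ev -> is_exponential (fmap G p) (fmap G q) (fmap G ev).

(** * Elementary toposes *)

Definition is_subobject_classifier (C : Category) (T Omega : C) (true : Hom T Omega) :
    Prop :=
  is_terminal T /\
  forall (U X : C) (m : Hom U X), is_mono m ->
    exists! chi : Hom X Omega, exists t : Hom U T, is_pullback chi true m t.

Definition has_subobject_classifier (C : Category) : Prop :=
  exists (T Omega : C) (true : Hom T Omega), is_subobject_classifier true.

Record Topos : Type := {
  topos_cat :> Category;
  topos_finite_limits : has_finite_limits topos_cat;
  topos_exponentials : has_exponentials topos_cat;
  topos_classifier : has_subobject_classifier topos_cat
}.

(* The preorder of monomorphisms into [X], which represent the subobjects of [X]. *)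
Definition sub_le (C : Category) (X U V : C) (m : Hom U X) (n : Hom V X) : Prop :=
  exists k : Hom U V, n ∘ k = m.

(* Complements in the lattice of subobjects of [X]: the meet of [m] and [n] is the
   least subobject and their join is the greatest one. *)
Definition is_complement (C : Category) (X U V : C) (m : Hom U X) (n : Hom V X) : Prop :=
  (forall (S : C) (s : Hom S X), is_mono s -> sub_le s m -> sub_le s n ->
     forall (T : C) (t : Hom T X), is_mono t -> sub_le s t) /\
  (forall (S : C) (s : Hom S X), is_mono s -> sub_le m s -> sub_le n s ->
     forall (T : C) (t : Hom T X), is_mono t -> sub_le t s).

Definition is_boolean (E : Topos) : Prop :=
  forall (X U : E) (m : Hom U X), is_mono m ->
    exists (V : E) (n : Hom V X), is_mono n /\ is_complement m n.

(** * Geometric morphisms *)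

Record GeometricMorphism (F E : Topos) : Type := {
  inverse_image : Functor E F;
  direct_image : Functor F E;
  geom_adjunction : Adjunction inverse_image direct_image;
  inverse_image_lex : preserves_finite_limits inverse_image
}.

Record Essential (F E : Topos) (f : GeometricMorphism F E) : Type := {
  shriek : Functor F E;
  shriek_adjunction : Adjunction shriek (inverse_image f)
}.

(* Here P = X ×_{f^*B} f^*A and Q = f_!X ×_B A, the map f_!X -> B being the transpose
   of [x].  The universal property of [Q] makes [k] the unique morphism satisfying
   the two equations: it is the natural comparison f_!P -> Q. *)
Definition locally_connected (F E : Topos) (f : GeometricMorphism F E) : Prop :=
  exists f_ess : Essential f,
  let f_star := inverse_image f in
  let f_shriek := shriek f_ess in
  let adj := shriek_adjunction f_ess in
  forall (A B : E) (a : Hom A B) (X : F) (x : Hom X (f_star B))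
    (P : F) (p1 : Hom P X) (p2 : Hom P (f_star A))
    (Q : E) (q1 : Hom Q (f_shriek X)) (q2 : Hom Q A),
    is_pullback x (fmap f_star a) p1 p2 ->
    is_pullback (to_left adj x) a q1 q2 ->
    exists k : Hom (f_shriek P) Q,
      (q1 ∘ k = fmap f_shriek p1 /\ q2 ∘ k = to_left adj p2) /\ is_iso k.

Definition is_CILC (E : Topos) : Prop :=
  forall (F : Topos) (f : GeometricMorphism F E),
    preserves_exponentials (inverse_image f) -> locally_connected f.

(* Main.v *)
From Stdlib Require Import ssreflect ssrbool ClassicalEpsilon List.
Require Import Defs.

Set Implicit Arguments.
Unset Strict Implicit.
Unset Printing Implicit Defensive.
Local Open Scope cat_scope.

(** Let f : F -> E be a geometric morphism whose inverse image preserves exponentials.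

    The left adjoint f_! exists over any elementary topos E. For X in F, a morphism
    X -> f^* (Pow B) = (f^* Omega)^(f^* B) corresponds to a morphism B -> T, where T is
    the direct image of (f^* Omega)^X, so that the functor sending B to the set of
    morphisms X -> f^* (Pow B) is represented by T ([universal_relation]). By
    representability T acquires a structure map alpha : Pow (Pow T) -> T, and
    as in the proof of monadicity of Pow : E^op -> E, f_! X is the equalizer of
    Pow alpha and the unit at Pow T. Its universal property needs to be verified for
    power objects only ([universal_arrow_of_pow]), where it reduces to the
    injectivity of power objects ([universal_arrow_exists]).

    Since f^* preserves exponentials, f_! (X × f^* A) = f_! X × A
    ([universal_arrow_prod]). Now let E be Boolean. The fibre product of f_! X and A
    over B is a subobject Q of f_! X × A, hence has a complement Q'. The product
    f_! X × A is the coproduct of Q and Q', and X × f^* A is the coproduct of the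
    pullbacks P and P' of f^* Q and f^* Q'; this rests on the stability of coverings
    under base change ([covers_pullback]) and on the fact that two disjoint
    subobjects which cover an object present it as a coproduct ([covers_glue]).
    Extending morphisms to power objects by a constant on the complements, one
    deduces the universal property of P -> f^* Q from that of
    X × f^* A -> f^* (f_! X × A) ([universal_arrow_restrict]). As P is the fibre
    product of X and f^* A, this says that the comparison f_! P -> Q is an
    isomorphism. *)

(** * Products, pullbacks and exponentials *)

Lemma comp_congr (C : Category) (W X Y Z : C) (g : Hom Y Z) (f : Hom X Y) (h : Hom X Z) :
  g ∘ f = h -> forall k : Hom W X, g ∘ (f ∘ k) = h ∘ k.
Proof. by move=> <- k; rewrite comp_assoc. Qed.

Lemma mono_comp (C : Category) (X Y Z : C) (g : Hom Y Z) (f : Hom X Y) :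
  is_mono g -> is_mono f -> is_mono (g ∘ f).
Proof. by move=> hg hf W a b; rewrite -!comp_assoc => /hg /hf. Qed.

Lemma product_ext (C : Category) (X Y P : C) (p : Hom P X) (q : Hom P Y) :
  is_product p q -> forall (W : C) (g h : Hom W P),
    p ∘ g = p ∘ h -> q ∘ g = q ∘ h -> g = h.
Proof.
move=> hP W g h ep eq.
have [k [_ uk]] := hP W (p ∘ h) (q ∘ h).
by rewrite -(uk g) // -(uk h).
Qed.

Lemma pullback_ext (C : Category) (X Y Z P : C) (f : Hom X Z) (g : Hom Y Z)
    (p : Hom P X) (q : Hom P Y) :
  is_pullback f g p q -> forall (W : C) (h k : Hom W P),
    p ∘ h = p ∘ k -> q ∘ h = q ∘ k -> h = k.
Proof.
move=> [e hP] W h k ep eq.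
have [|l [_ ul]] := hP W (p ∘ k) (q ∘ k); first by rewrite !comp_assoc e.
by rewrite -(ul h) // -(ul k).
Qed.

(** The base change of a monomorphism is a monomorphism. *)
Lemma pullback_mono (C : Category) (X Y Z P : C) (f : Hom X Z) (g : Hom Y Z)
    (p : Hom P X) (q : Hom P Y) :
  is_pullback f g p q -> is_mono g -> is_mono p.
Proof.
move=> hP hg W h k e; apply: (pullback_ext hP) => //.
apply: hg; case: hP => e' _.
by rewrite !comp_assoc -e' -!comp_assoc e.
Qed.

(** The morphism into a product with given components. *)
Definition pairing (C : Category) (X Y P : C) (p : Hom P X) (q : Hom P Y)
    (hP : is_product p q) (W : C) (f : Hom W X) (g : Hom W Y) : Hom W P :=
  proj1_sig (constructive_indefinite_description _ (hP W f g)).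

Section Pairing.
Context (C : Category) (X Y P : C) (p : Hom P X) (q : Hom P Y) (hP : is_product p q).

Lemma pairing_fst (W : C) (f : Hom W X) (g : Hom W Y) : p ∘ pairing hP f g = f.
Proof.
by rewrite /pairing; case: constructive_indefinite_description => k [[? ?] ?] /=.
Qed.

Lemma pairing_snd (W : C) (f : Hom W X) (g : Hom W Y) : q ∘ pairing hP f g = g.
Proof.
by rewrite /pairing; case: constructive_indefinite_description => k [[? ?] ?] /=.
Qed.

Lemma pairing_comp (V W : C) (f : Hom W X) (g : Hom W Y) (w : Hom V W) :
  pairing hP f g ∘ w = pairing hP (f ∘ w) (g ∘ w).
Proof.
by apply: (product_ext hP); rewrite comp_assoc ?pairing_fst ?pairing_snd.
Qed.

Lemma pairing_eta (W : C) (h : Hom W P) : pairing hP (p ∘ h) (q ∘ h) = h.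
Proof. by apply: (product_ext hP); rewrite ?pairing_fst ?pairing_snd. Qed.

Lemma pairing_inj (W : C) (f f' : Hom W X) (g g' : Hom W Y) :
  pairing hP f g = pairing hP f' g' -> f = f' /\ g = g'.
Proof.
by move=> e; split; [rewrite -(pairing_fst f g) e pairing_fst|
  rewrite -(pairing_snd f g) e pairing_snd].
Qed.

End Pairing.

Section Exponential.
Context (C : Category) (X Y E P : C) (p : Hom P E) (q : Hom P X) (ev : Hom P Y).
Context (hE : is_exponential p q ev).

(** The value [x(a)] of a generalized element [x] of Y^X at a generalized element
    [a] of X, both at the same stage. *)
Definition apply_exp (W : C) (x : Hom W E) (a : Hom W X) : Hom W Y :=
  ev ∘ pairing (proj1 hE) x a.

Lemma apply_exp_comp (V W : C) (x : Hom W E) (a : Hom W X) (w : Hom V W) :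
  apply_exp x a ∘ w = apply_exp (x ∘ w) (a ∘ w).
Proof. by rewrite /apply_exp -comp_assoc pairing_comp. Qed.

(** Currying, with W × X presented by any product diagram. *)
Lemma exp_curry (W Q : C) (p' : Hom Q W) (q' : Hom Q X) (g : Hom Q Y) :
  is_product p' q' -> exists h : Hom W E, apply_exp (h ∘ p') q' = g.
Proof.
move=> hQ; have [h [[k [e1 [e2 e3]]] _]] := proj2 hE W Q p' q' g hQ.
by exists h; rewrite /apply_exp -e3 -e1 -e2 pairing_eta.
Qed.

(** Morphisms into Y^X agree if they have the same values at the generic argument. *)
Lemma exp_ext (W Q : C) (p' : Hom Q W) (q' : Hom Q X) (h1 h2 : Hom W E) :
  is_product p' q' -> apply_exp (h1 ∘ p') q' = apply_exp (h2 ∘ p') q' -> h1 = h2.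
Proof.
move=> hQ e; have [h [_ uh]] := proj2 hE W Q p' q' (apply_exp (h2 ∘ p') q') hQ.
have e1 : h = h1 by apply: uh; exists (pairing (proj1 hE) (h1 ∘ p') q');
  rewrite pairing_fst pairing_snd.
have e2 : h = h2 by apply: uh; exists (pairing (proj1 hE) (h2 ∘ p') q');
  rewrite pairing_fst pairing_snd.
by rewrite -e1 -e2.
Qed.

End Exponential.

(** * Finite limits in a topos *)

(** The objects and arrows of the shape of a cospan, with apex [c_base]. *)
Inductive cospan_obj := c_left | c_right | c_base.

Definition cospan_hom (i j : cospan_obj) : Type :=
  match i, j with
  | c_left, c_left | c_left, c_base | c_right, c_right | c_right, c_base
  | c_base, c_base => unit
  | _, _ => Empty_set
  end.

(* In each clause of the composition after the first, one of the two arrows to be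
   composed does not exist. *)
Definition cospan_shape : Category.
Proof.
refine {| Obj := cospan_obj; Hom := cospan_hom;
  idm := fun i => match i with c_left | c_right | c_base => tt end;
  comp := fun i j k =>
    match i, j, k return cospan_hom j k -> cospan_hom i j -> cospan_hom i k with
    | c_left, _, c_left | c_left, _, c_base | c_right, _, c_right
    | c_right, _, c_base | c_base, _, c_base => fun _ _ => tt
    | c_left, c_left, c_right => fun g _ => g
    | c_left, c_right, c_right => fun _ f => f
    | c_left, c_base, c_right => fun g _ => g
    | c_right, c_left, c_left => fun _ f => f
    | c_right, c_right, c_left => fun g _ => g
    | c_right, c_base, c_left => fun g _ => g
    | c_base, c_left, c_left => fun _ f => f
    | c_base, c_right, c_left => fun _ f => f
    | c_base, c_base, c_left => fun g _ => g
    | c_base, c_left, c_right => fun _ f => f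
    | c_base, c_right, c_right => fun _ f => f
    | c_base, c_base, c_right => fun g _ => g
    end |}.
- by case=> -[] // [].
- by case=> -[] // [].
- by case=> -[] [] [] // h g f; case: f; case: g; case: h.
Defined.

Lemma cospan_shape_finite : finite_category cospan_shape.
Proof.
split; first by exists (c_left :: c_right :: c_base :: nil); case; simpl; auto.
by move=> [] []; (exists (tt :: nil); case; simpl; by auto) || (exists nil; case).
Qed.

Definition cospan (C : Category) (X Y Z : C) (f : Hom X Z) (g : Hom Y Z) :
  Functor cospan_shape C.
Proof.
pose o (i : cospan_obj) := match i with c_left => X | c_right => Y | c_base => Z end.
refine {| fobj := o : cospan_shape -> C;
  fmap := fun i j => match i, j return cospan_hom i j -> Hom (o i) (o j) with
    | c_left, c_left | c_right, c_right | c_base, c_base => fun _ => idm _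
    | c_left, c_base => fun _ => f
    | c_right, c_base => fun _ => g
    | c_left, c_right | c_right, c_left | c_base, c_left | c_base, c_right =>
        fun e => match e with end
    end |}.
- by case.
- by case=> -[] [] //= h k; rewrite ?comp_idl ?comp_idr //; case: h; case: k.
Defined.

Definition left_arrow : @Hom cospan_shape c_left c_base := tt.
Definition right_arrow : @Hom cospan_shape c_right c_base := tt.

Lemma cone_of_square_natural (C : Category) (D : Functor cospan_shape C) (W : C)
    (u : Hom W (D c_left)) (v : Hom W (D c_right)) :
  fmap D left_arrow ∘ u = fmap D right_arrow ∘ v ->
  let l (j : cospan_shape) : Hom W (D j) := match j with
    | c_left => u | c_right => v | c_base => fmap D left_arrow ∘ u end in
  forall (i j : cospan_shape) (a : Hom i j), fmap D a ∘ l i = l j.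
Proof.
move=> e l [] [] [] //=.
- by rewrite (fmap_id D (c_left : cospan_shape)) comp_idl.
- by rewrite (fmap_id D (c_right : cospan_shape)) comp_idl.
- by rewrite (fmap_id D (c_base : cospan_shape)) comp_idl.
Qed.

Definition cone_of_square (C : Category) (D : Functor cospan_shape C) (W : C)
    (u : Hom W (D c_left)) (v : Hom W (D c_right))
    (e : fmap D left_arrow ∘ u = fmap D right_arrow ∘ v) : Cone D :=
  {| vertex := W; leg := _; leg_natural := cone_of_square_natural e |}.

Lemma limit_pullback (C : Category) (D : Functor cospan_shape C) (K : Cone D) :
  is_limit K ->
  is_pullback (fmap D left_arrow) (fmap D right_arrow) (leg K c_left) (leg K c_right).
Proof.
move=> hK; split; first by rewrite !leg_natural.
move=> W u v e; have [h [eh uh]] := hK (cone_of_square e).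
exists h; split; first by split; [exact: (eh c_left)|exact: (eh c_right)].
move=> h' [e1 e2]; apply: uh; case=> //=.
by rewrite -e1 -(leg_natural K left_arrow) comp_assoc.
Qed.

Lemma pullback_limit (C : Category) (X Y Z P : C) (f : Hom X Z) (g : Hom Y Z)
    (p : Hom P X) (q : Hom P Y) (e : f ∘ p = g ∘ q) :
  is_pullback f g p q -> is_limit (@cone_of_square C (cospan f g) P p q e).
Proof.
move=> [_ hP] K.
have [|h [[e1 e2] uh]] := hP K (leg K c_left) (leg K c_right).
  by rewrite (leg_natural K left_arrow) (leg_natural K right_arrow).
exists h; split.
- by case=> //=; rewrite -comp_assoc e1; exact: (leg_natural K left_arrow).
- by move=> h' eh; apply: uh; split; [exact: (eh c_left)|exact: (eh c_right)].
Qed.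

Lemma pullback_exists (C : Category) : has_finite_limits C ->
  forall (X Y Z : C) (f : Hom X Z) (g : Hom Y Z),
  exists (P : C) (p : Hom P X) (q : Hom P Y), is_pullback f g p q.
Proof.
move=> hC X Y Z f g; have [K hK] := hC _ (cospan f g) cospan_shape_finite.
by exists K, (leg K c_left), (leg K c_right); exact: (limit_pullback hK).
Qed.

Lemma lex_pullback (C C' : Category) (G : Functor C C') :
  preserves_finite_limits G ->
  forall (X Y Z P : C) (f : Hom X Z) (g : Hom Y Z) (p : Hom P X) (q : Hom P Y),
  is_pullback f g p q -> is_pullback (fmap G f) (fmap G g) (fmap G p) (fmap G q).
Proof.
move=> hG X Y Z P f g p q hP.
have hK := pullback_limit (proj1 hP) hP.
exact: (limit_pullback (hG _ _ _ cospan_shape_finite hK)).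
Qed.

Definition empty_shape : Category.
Proof.
by refine {| Obj := Empty_set; Hom := fun _ _ => Empty_set;
  idm := fun i => match i with end;
  comp := fun i _ _ _ _ => match i with end |}; case.
Defined.

Definition empty_diagram (C : Category) : Functor empty_shape C.
Proof.
by refine {| fobj := fun i : empty_shape => match i with end;
  fmap := fun (i j : empty_shape) _ => match i with end |}; case.
Defined.

Definition empty_cone (C : Category) (D : Functor empty_shape C) (T : C) : Cone D.
Proof.
by refine {| vertex := T; leg := fun i : empty_shape => match i with end |}; case.
Defined.

Lemma lex_terminal (C C' : Category) (G : Functor C C') (T : C) :
  preserves_finite_limits G -> is_terminal T -> is_terminal (G T).
Proof.
move=> hG hT.
have hK : is_limit (empty_cone (empty_diagram C) T).
  move=> K; have [h [_ uh]] := hT K.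
  by exists h; split; [case|move=> h' _; exact: uh].
have fin : finite_category empty_shape by split; [exists nil; case|case].
move=> X; have [h [_ uh]] := hG _ _ _ fin hK (empty_cone _ X).
by exists h; split=> // h' _; apply: uh; case.
Qed.

Lemma product_of_pullback (C : Category) (X Y T P : C) (f : Hom X T) (g : Hom Y T)
    (p : Hom P X) (q : Hom P Y) :
  is_terminal T -> is_pullback f g p q -> is_product p q.
Proof.
move=> hT [_ hP] W u v; apply: hP.
by have [k [_ uk]] := hT W; rewrite -(uk (f ∘ u)) // -(uk (g ∘ v)).
Qed.

Lemma pullback_of_product (C : Category) (X Y T P : C) (f : Hom X T) (g : Hom Y T)
    (p : Hom P X) (q : Hom P Y) :
  is_terminal T -> is_product p q -> is_pullback f g p q.
Proof.
move=> hT hP; split=> [|W u v _]; last exact: hP.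
by have [k [_ uk]] := hT P; rewrite -(uk (f ∘ p)) // -(uk (g ∘ q)).
Qed.

(** A terminal object, a subobject classifier, binary products and exponentials are
    now chosen in each topos; the morphisms [to_one], [pairing] and currying are
    unique. *)

Section ToposStructure.
Context (C : Topos).

Lemma topos_classifier_sig :
  {T : C & {Omega : C & {true : Hom T Omega | is_subobject_classifier true}}}.
Proof.
have [T hT] := constructive_indefinite_description _ (topos_classifier C).
have [O hO] := constructive_indefinite_description _ hT.
by exists T, O; exact: constructive_indefinite_description.
Qed.

Definition one : C := projT1 topos_classifier_sig.
Definition Omega : C := projT1 (projT2 topos_classifier_sig).
Definition true_point : Hom one Omega := proj1_sig (projT2 (projT2 topos_classifier_sig)).

Lemma true_point_classifier : is_subobject_classifier true_point.
Proof. exact: (proj2_sig (projT2 (projT2 topos_classifier_sig))). Qed.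

Lemma one_terminal : is_terminal one.
Proof. exact: (proj1 true_point_classifier). Qed.

Definition to_one (X : C) : Hom X one :=
  proj1_sig (constructive_indefinite_description _ (one_terminal X)).

Lemma to_one_unique (X : C) (f g : Hom X one) : f = g.
Proof. by have [h [_ uh]] := one_terminal X; rewrite -(uh f) // -(uh g). Qed.

Lemma product_sig (X Y : C) :
  {P : C & {p : Hom P X & {q : Hom P Y | is_product p q}}}.
Proof.
have H : exists (P : C) (p : Hom P X) (q : Hom P Y), is_product p q.
  have [P [p [q hP]]] :=
    pullback_exists (@topos_finite_limits C) (to_one X) (to_one Y).
  by exists P, p, q; exact: (product_of_pullback one_terminal hP).
have [P hP] := constructive_indefinite_description _ H.
have [p hp] := constructive_indefinite_description _ hP.
by exists P, p; exact: constructive_indefinite_description.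
Qed.

Definition prod (X Y : C) : C := projT1 (product_sig X Y).
Definition pr1 (X Y : C) : Hom (prod X Y) X := projT1 (projT2 (product_sig X Y)).
Definition pr2 (X Y : C) : Hom (prod X Y) Y :=
  proj1_sig (projT2 (projT2 (product_sig X Y))).

Lemma prod_product (X Y : C) : is_product (pr1 X Y) (pr2 X Y).
Proof. exact: (proj2_sig (projT2 (projT2 (product_sig X Y)))). Qed.

Arguments prod_product : clear implicits.

Lemma exponential_sig (X Y : C) :
  {E : C & {P : C & {p : Hom P E & {q : Hom P X & {ev : Hom P Y |
    is_exponential p q ev}}}}}.
Proof.
have [E hE] := constructive_indefinite_description _ (topos_exponentials X Y).
have [P hP] := constructive_indefinite_description _ hE.
have [p hp] := constructive_indefinite_description _ hP.
have [q hq] := constructive_indefinite_description _ hp.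
by exists E, P, p, q; exact: constructive_indefinite_description.
Qed.

(** [exp X Y] is Y^X, and [exp_dom X Y] is the product Y^X × X on which the evaluation
    is defined. *)
Definition exp (X Y : C) : C := projT1 (exponential_sig X Y).
Definition exp_dom (X Y : C) : C := projT1 (projT2 (exponential_sig X Y)).
Definition exp_pr1 (X Y : C) : Hom (exp_dom X Y) (exp X Y) :=
  projT1 (projT2 (projT2 (exponential_sig X Y))).
Definition exp_pr2 (X Y : C) : Hom (exp_dom X Y) X :=
  projT1 (projT2 (projT2 (projT2 (exponential_sig X Y)))).
Definition exp_ev (X Y : C) : Hom (exp_dom X Y) Y :=
  proj1_sig (projT2 (projT2 (projT2 (projT2 (exponential_sig X Y))))).

Lemma exp_exponential (X Y : C) :
  is_exponential (exp_pr1 X Y) (exp_pr2 X Y) (exp_ev X Y).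
Proof. exact: (proj2_sig (projT2 (projT2 (projT2 (projT2 (exponential_sig X Y)))))). Qed.

Arguments exp_exponential : clear implicits.

Lemma equalizer_exists (X Y : C) (g h : Hom X Y) :
  exists (S : C) (e : Hom S X), [/\ is_mono e, g ∘ e = h ∘ e &
    forall (W : C) (x : Hom W X), g ∘ x = h ∘ x -> exists k : Hom W S, e ∘ k = x].
Proof.
pose pr f := pairing (prod_product X Y) (idm X) f.
have [S [e [e' hS]]] := pullback_exists (@topos_finite_limits C) (pr g) (pr h).
have hpr f W (x : Hom W X) : pr f ∘ x = pairing (prod_product X Y) x (f ∘ x).
  by rewrite /pr pairing_comp comp_idl.
case: (hS) => eq uS; move: eq; rewrite !hpr => /pairing_inj [ee e2].
exists S, e; split.
- by move=> W a b eab; apply: (pullback_ext hS) => //; rewrite -ee.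
- by rewrite e2 ee.
- move=> W x ex; have [|k [[ek _] _]] := uS W x x; first by rewrite !hpr ex.
  by exists k.
Qed.

End ToposStructure.

Arguments prod_product {C} X Y.
Arguments exp_exponential {C} X Y.
Arguments to_one {C} X.
Arguments Omega {C}.
Arguments true_point {C}.
Notation "⟨ f , g ⟩" := (pairing (prod_product _ _) f g) (at level 0) : cat_scope.
(* The value of [x] at [a], for [x] a generalized element of a chosen exponential. *)
Notation "x @@ a" := (apply_exp (exp_exponential _ _) x a)
  (at level 30, right associativity) : cat_scope.

(** * Subobjects and power objects *)

Section Subobjects.
Context (C : Topos).

(** The truth value [a] at stage [W] is the constant one with value true. *)
Definition holds (W : C) (a : Hom W Omega) : Prop := a = true_point ∘ to_one W.

Lemma holds_comp (V W : C) (a : Hom W Omega) (w : Hom V W) : holds a -> holds (a ∘ w).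
Proof.
by rewrite /holds => ->; rewrite -comp_assoc; congr comp; apply: to_one_unique.
Qed.

Lemma point_mono (W : C) (t : Hom (one C) W) : is_mono t.
Proof. by move=> V g h _; apply: to_one_unique. Qed.

(** Every truth value over [X] is the characteristic morphism of the subobject of
    [X] on which it holds. *)
Lemma comprehension (X : C) (chi : Hom X Omega) :
  exists (U : C) (m : Hom U X), is_mono m /\
    forall (W : C) (x : Hom W X), holds (chi ∘ x) <-> exists u : Hom W U, m ∘ u = x.
Proof.
have [U [m [t hU]]] := pullback_exists (@topos_finite_limits C) chi true_point.
exists U, m; split; first by apply: (pullback_mono hU); exact: point_mono.
move=> W x; split.
- by move=> hx; have [k [[ek _] _]] := proj2 hU W x (to_one W) hx; exists k.
- move=> [u <-]; rewrite comp_assoc; apply: holds_comp.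
  rewrite /holds (proj1 hU); congr comp; exact: to_one_unique.
Qed.

Lemma pullback_true (U X : C) (m : Hom U X) (chi : Hom X Omega) : is_mono m ->
  (forall (W : C) (x : Hom W X), holds (chi ∘ x) <-> exists u : Hom W U, m ∘ u = x) ->
  is_pullback chi true_point m (to_one U).
Proof.
move=> hm hchi; split.
  have : holds (chi ∘ m) by apply/hchi; exists (idm U); rewrite comp_idr.
  by [].
move=> W u v e.
have /hchi [k ek] : holds (chi ∘ u) by rewrite /holds e; congr comp; exact: to_one_unique.
exists k; split; first by split=> //; exact: to_one_unique.
by move=> k' [ek' _]; apply: hm; rewrite ek ek'.
Qed.

(** Truth values are determined by the stages of definition at which they hold. *)
Lemma holds_ext (X : C) (a b : Hom X Omega) :
  (forall (W : C) (x : Hom W X), holds (a ∘ x) <-> holds (b ∘ x)) -> a = b.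
Proof.
move=> hab; have [U [m [hm hU]]] := comprehension a.
have [chi [_ uchi]] := proj2 (true_point_classifier C) U X m hm.
have <- : chi = a by apply: uchi; exists (to_one U); apply: pullback_true.
apply: uchi; exists (to_one U); apply: pullback_true => // W x.
by rewrite -hab.
Qed.

Lemma classify (U X : C) (m : Hom U X) : is_mono m ->
  exists chi : Hom X Omega, forall (W : C) (x : Hom W X),
    holds (chi ∘ x) <-> exists u : Hom W U, m ∘ u = x.
Proof.
move=> hm; have [chi [[t hP] _]] := proj2 (true_point_classifier C) U X m hm.
exists chi => W x; split.
- by move=> hx; have [k [[ek _] _]] := proj2 hP W x (to_one W) hx; exists k.
- move=> [u <-]; rewrite comp_assoc; apply: holds_comp.
  rewrite /holds (proj1 hP); congr comp; exact: to_one_unique.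
Qed.

Lemma app_ext (X Y W : C) (x y : Hom W (exp X Y)) :
  (forall (V : C) (w : Hom V W) (a : Hom V X), (x ∘ w) @@ a = (y ∘ w) @@ a) -> x = y.
Proof. by move=> e; apply: (exp_ext (hE := exp_exponential X Y) (prod_product W X)); exact: e. Qed.

Lemma app_curry (X Y W : C) (g : Hom (prod W X) Y) :
  exists x : Hom W (exp X Y),
    forall (V : C) (w : Hom V W) (a : Hom V X), (x ∘ w) @@ a = g ∘ ⟨w, a⟩.
Proof.
have [x ex] := exp_curry (exp_exponential X Y) g (prod_product W X).
exists x => V w a; rewrite -ex apply_exp_comp -comp_assoc.
by rewrite pairing_fst pairing_snd.
Qed.

Definition Pow (A : C) : C := exp A Omega.

Lemma pow_ext (A W : C) (x y : Hom W (Pow A)) :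
  (forall (V : C) (w : Hom V W) (a : Hom V A),
     holds ((x ∘ w) @@ a) <-> holds ((y ∘ w) @@ a)) -> x = y.
Proof.
move=> e; apply: app_ext => V w a; apply: holds_ext => V' v.
by rewrite !apply_exp_comp -!comp_assoc e.
Qed.

Lemma pow_comprehension (A W R : C) (r : Hom R (prod W A)) : is_mono r ->
  exists x : Hom W (Pow A), forall (V : C) (w : Hom V W) (a : Hom V A),
    holds ((x ∘ w) @@ a) <-> exists k : Hom V R, r ∘ k = ⟨w, a⟩.
Proof.
move=> /classify [chi hchi]; have [x hx] := app_curry chi.
by exists x => V w a; rewrite hx.
Qed.

(** The inverse image action Pow B -> Pow A of a morphism A -> B. *)
Lemma pow_map_sig (A B : C) (t : Hom A B) :
  {f : Hom (Pow B) (Pow A) | forall (W : C) (y : Hom W (Pow B)) (a : Hom W A),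
     (f ∘ y) @@ a = y @@ (t ∘ a)}.
Proof.
apply: constructive_indefinite_description.
have [f hf] := app_curry (pr1 (Pow B) A @@ (t ∘ pr2 (Pow B) A)).
exists f => W y a; rewrite hf apply_exp_comp -comp_assoc.
by rewrite pairing_fst pairing_snd.
Qed.

Definition pow_map (A B : C) (t : Hom A B) : Hom (Pow B) (Pow A) :=
  proj1_sig (pow_map_sig t).

Lemma pow_mapE (A B W : C) (t : Hom A B) (y : Hom W (Pow B)) (a : Hom W A) :
  (pow_map t ∘ y) @@ a = y @@ (t ∘ a).
Proof. exact: (proj2_sig (pow_map_sig t)). Qed.

Lemma pow_map_comp (A B D : C) (t : Hom A B) (u : Hom B D) :
  pow_map (u ∘ t) = pow_map t ∘ pow_map u.
Proof.
by apply: app_ext => V w a; rewrite -comp_assoc !pow_mapE comp_assoc.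
Qed.

(** The principal ultrafilter map A -> Pow (Pow A). *)
Lemma eta_sig (A : C) :
  {f : Hom A (Pow (Pow A)) | forall (W : C) (a : Hom W A) (y : Hom W (Pow A)),
     (f ∘ a) @@ y = y @@ a}.
Proof.
apply: constructive_indefinite_description.
have [f hf] := app_curry (pr2 A (Pow A) @@ pr1 A (Pow A)).
exists f => W a y; rewrite hf apply_exp_comp.
by rewrite pairing_fst pairing_snd.
Qed.

Definition eta (A : C) : Hom A (Pow (Pow A)) := proj1_sig (eta_sig A).

Lemma etaE (A W : C) (a : Hom W A) (y : Hom W (Pow A)) : (eta A ∘ a) @@ y = y @@ a.
Proof. exact: (proj2_sig (eta_sig A)). Qed.

(** Pow is adjoint to itself on the right: morphisms Y -> Pow B and B -> Pow Y
    both correspond to relations between Y and B. *)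
Lemma pow_transpose (B Y : C) (g : Hom Y (Pow B)) :
  exists c : Hom B (Pow Y), g = pow_map c ∘ eta Y.
Proof.
have [c hc] := app_curry ((g ∘ pr2 B Y) @@ pr1 B Y).
exists c; apply: app_ext => V y b; rewrite -comp_assoc pow_mapE etaE hc.
by rewrite apply_exp_comp -comp_assoc pairing_fst pairing_snd.
Qed.

(** Power objects are injective; the extension of [g] constructed here takes the
    value empty outside of the subobject. *)
Lemma pow_injective (B S Y : C) (e : Hom S Y) (g : Hom S (Pow B)) : is_mono e ->
  exists h : Hom Y (Pow B), h ∘ e = g /\
    forall (W : C) (y : Hom W Y) (b : Hom W B),
      holds ((h ∘ y) @@ b) -> exists k : Hom W S, e ∘ k = y.
Proof.
move=> he.
have [R [r [hr hR]]] := comprehension ((g ∘ pr1 S B) @@ pr2 S B).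
have hgr W (s : Hom W S) (b : Hom W B) :
    ((g ∘ pr1 S B) @@ pr2 S B) ∘ ⟨s, b⟩ = (g ∘ s) @@ b.
  by rewrite apply_exp_comp -comp_assoc pairing_fst pairing_snd.
have [|h hh] := @pow_comprehension B Y R ⟨e ∘ (pr1 S B ∘ r), pr2 S B ∘ r⟩.
  move=> W u v; rewrite !pairing_comp => /pairing_inj [].
  rewrite -!comp_assoc => /he e1 e2; apply: hr.
  exact: (product_ext (prod_product S B)).
exists h; split.
- apply: pow_ext => V s b; rewrite -comp_assoc hh -hgr hR.
  split=> -[k].
  + rewrite pairing_comp => /pairing_inj []; rewrite -!comp_assoc => /he e1 e2.
    by exists k; apply: (product_ext (prod_product S B));
      rewrite ?pairing_fst ?pairing_snd.
  + by move=> ek; exists k; rewrite pairing_comp -!comp_assoc ek pairing_fst pairing_snd.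
- move=> W y b; rewrite hh => -[k]; rewrite pairing_comp => /pairing_inj [].
  by rewrite -!comp_assoc => e1 _; eexists; exact: e1.
Qed.

(** The singleton morphism A -> Pow A. *)
Lemma singleton_sig (A : C) :
  {f : Hom A (Pow A) | forall (W : C) (a b : Hom W A), holds ((f ∘ a) @@ b) <-> a = b}.
Proof.
apply: constructive_indefinite_description.
have [|f hf] := @pow_comprehension A A A ⟨idm A, idm A⟩.
  by move=> W u v; rewrite !pairing_comp !comp_idl => /pairing_inj [].
exists f => W a b; rewrite hf; split.
- by move=> [k]; rewrite pairing_comp !comp_idl => /pairing_inj [<- <-].
- by move=> ->; exists b; rewrite pairing_comp !comp_idl.
Qed.

Definition singleton (A : C) : Hom A (Pow A) := proj1_sig (singleton_sig A).

Lemma singletonE (A W : C) (a b : Hom W A) :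
  holds ((singleton A ∘ a) @@ b) <-> a = b.
Proof. exact: (proj2_sig (singleton_sig A)). Qed.

Lemma singleton_mono (A : C) : is_mono (singleton A).
Proof.
move=> W a b e; symmetry; apply/singletonE; rewrite -e; exact/singletonE.
Qed.

(** The global element of Pow A that is the whole of [A]. *)
Lemma pow_point (A : C) : exists x : Hom (one C) (Pow A), True.
Proof. by have [x _] := app_curry (true_point ∘ to_one (prod (one C) A)); exists x. Qed.

(** * Coverings by two subobjects *)

(** Any two parallel morphisms out of [W] agree. In a topos this says that [W] is
    initial, but only this consequence of initiality is needed. *)
Definition degenerate (W : C) : Prop := forall (X : C) (g h : Hom W X), g = h.

(** Every subobject of [Y] that contains [m] and [n] is the greatest one. *)
Definition covers (U V Y : C) (m : Hom U Y) (n : Hom V Y) : Prop :=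
  forall (S : C) (s : Hom S Y), is_mono s -> sub_le m s -> sub_le n s ->
    exists k : Hom Y S, s ∘ k = idm Y.

(** The intersection of [m] and [n] is initial. *)
Definition disjoint (U V Y : C) (m : Hom U Y) (n : Hom V Y) : Prop :=
  forall (W : C) (p : Hom W U) (q : Hom W V), m ∘ p = n ∘ q -> degenerate W.

Lemma covers_ext (U V Y X : C) (m : Hom U Y) (n : Hom V Y) (g h : Hom Y X) :
  covers m n -> g ∘ m = h ∘ m -> g ∘ n = h ∘ n -> g = h.
Proof.
move=> hc em en; have [S [e [he eq ue]]] := equalizer_exists g h.
have [k ek] := hc S e he (ue _ _ em) (ue _ _ en).
by rewrite -(comp_idr g) -(comp_idr h) -ek !comp_assoc eq.
Qed.

Lemma disjoint_sym (U V Y : C) (m : Hom U Y) (n : Hom V Y) :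
  disjoint m n -> disjoint n m.
Proof. by move=> hd W p q e; apply: (hd W q p). Qed.

(** Here [u'] extends the singleton map of [u] to [Y], and [v'] is empty outside of
    [V]. At a point [y] of [U], the equality between the truth values of c in u'(y)
    and y in U says that c = u(y), while the one between c in v'(y) and y in V holds
    because both are false. *)
Lemma glue_condition (U V Y X : C) (m : Hom U Y) (n : Hom V Y) (u : Hom U X)
    (u' v' : Hom Y (Pow X)) (chiU chiV : Hom Y Omega) :
  disjoint m n -> u' ∘ m = singleton X ∘ u ->
  (forall (W : C) (y : Hom W Y) (c : Hom W X),
     holds ((v' ∘ y) @@ c) -> exists k : Hom W V, n ∘ k = y) ->
  (forall (W : C) (y : Hom W Y), holds (chiU ∘ y) <-> exists k : Hom W U, m ∘ k = y) ->
  (forall (W : C) (y : Hom W Y), holds (chiV ∘ y) <-> exists k : Hom W V, n ∘ k = y) ->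
  forall (W : C) (x : Hom W U) (c : Hom W X),
  (u' ∘ (m ∘ x)) @@ c = chiU ∘ (m ∘ x) /\ (v' ∘ (m ∘ x)) @@ c = chiV ∘ (m ∘ x) <->
  holds ((singleton X ∘ (u ∘ x)) @@ c).
Proof.
move=> hd eu sv hU hV W x c.
have hx : holds (chiU ∘ (m ∘ x)) by apply/hU; exists x.
rewrite (comp_congr eu) -comp_assoc; split; first by move=> [-> _].
move=> hc; split; first by rewrite hc hx.
have dg W' (t : Hom W' W) (k : Hom W' V) : n ∘ k = m ∘ (x ∘ t) -> degenerate W'.
  by move=> e; apply: (hd W' (x ∘ t) k).
apply: holds_ext => W' t; rewrite apply_exp_comp -!comp_assoc; split.
- by move=> h; have [k ek] := sv _ _ _ h; exact: (dg _ _ _ ek).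
- by move=> h; have [k ek] := proj1 (hV _ _) h; exact: (dg _ _ _ ek).
Qed.

(** Disjoint subobjects that cover [Y] present it as their coproduct. *)
Lemma covers_glue (U V Y X : C) (m : Hom U Y) (n : Hom V Y)
    (u : Hom U X) (v : Hom V X) :
  is_mono m -> is_mono n -> covers m n -> disjoint m n ->
  exists g : Hom Y X, g ∘ m = u /\ g ∘ n = v.
Proof.
move=> hm hn hc hd.
have [u' [eu su]] := pow_injective (singleton X ∘ u) hm.
have [v' [ev sv]] := pow_injective (singleton X ∘ v) hn.
have [chiU hU] := classify hm; have [chiV hV] := classify hn.
(* [w y] is the set of those c such that the truth values of c in u'(y) and y in U
   are equal, and so are those of c in v'(y) and y in V: it is {u(y)} over U and
   {v(y)} over V. Then w(y) is a singleton for all y, since this holds over U and V. *)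
have [R [r [hr er uR]]] := equalizer_exists
  ⟨(u' ∘ pr1 Y X) @@ pr2 Y X, (v' ∘ pr1 Y X) @@ pr2 Y X⟩
  ⟨chiU ∘ pr1 Y X, chiV ∘ pr1 Y X⟩.
have [w hw] := pow_comprehension hr.
have hwE W (y : Hom W Y) (c : Hom W X) : holds ((w ∘ y) @@ c) <->
    (u' ∘ y) @@ c = chiU ∘ y /\ (v' ∘ y) @@ c = chiV ∘ y.
  have E1 : ⟨(u' ∘ pr1 Y X) @@ pr2 Y X, (v' ∘ pr1 Y X) @@ pr2 Y X⟩ ∘ ⟨y, c⟩ =
            ⟨(u' ∘ y) @@ c, (v' ∘ y) @@ c⟩.
    by rewrite pairing_comp !apply_exp_comp -!comp_assoc pairing_fst pairing_snd.
  have E2 : ⟨chiU ∘ pr1 Y X, chiV ∘ pr1 Y X⟩ ∘ ⟨y, c⟩ = ⟨chiU ∘ y, chiV ∘ y⟩.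
    by rewrite pairing_comp -!comp_assoc pairing_fst.
  rewrite hw; split=> [[k ek]|[e1 e2]].
    by apply: (pairing_inj (hP := prod_product _ _)); rewrite -E1 -E2 -ek !comp_assoc er.
  by apply: uR; rewrite E1 E2 e1 e2.
have wm : w ∘ m = singleton X ∘ u.
  apply: pow_ext => W x c; rewrite -!comp_assoc hwE.
  exact: (glue_condition hd eu sv hU hV).
have wn : w ∘ n = singleton X ∘ v.
  apply: pow_ext => W x c; rewrite -!comp_assoc hwE and_comm.
  exact: (glue_condition (disjoint_sym hd) ev su hV hU).
have [chi hchi] := classify (@singleton_mono X).
have [S [s [hs hS]]] := comprehension (chi ∘ w).
have sm : sub_le m s by apply/hS; rewrite -comp_assoc wm; apply/hchi; exists u.
have sn : sub_le n s by apply/hS; rewrite -comp_assoc wn; apply/hchi; exists v.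
have [k ek] := hc S s hs sm sn.
have : holds (chi ∘ w ∘ idm Y) by apply/hS; exists k.
rewrite comp_idr => /hchi [g eg]; exists g.
by split; apply: singleton_mono; rewrite comp_assoc eg.
Qed.

(** Coverings are stable under base change. *)
Lemma covers_pullback (U V Y Z P P' : C) (m : Hom U Y) (n : Hom V Y) (c : Hom Z Y)
    (i : Hom P Z) (r : Hom P U) (i' : Hom P' Z) (r' : Hom P' V) :
  covers m n -> is_pullback c m i r -> is_pullback c n i' r' -> covers i i'.
Proof.
move=> hc hP hP' S s hs hi hi'.
(* The relations c(z) = y and c(z) = y, z in S between y and z agree for y in U and
   for y in V, hence for all y; for y = c(z) this says that z lies in S. *)
have [|a ha] := @pow_comprehension Z Y Z ⟨c, idm Z⟩.
  by move=> W k l; rewrite !pairing_comp !comp_idl => /pairing_inj [].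
have [|b hb] := @pow_comprehension Z Y S ⟨c ∘ s, s⟩.
  by move=> W k l; rewrite !pairing_comp => /pairing_inj [_ /hs].
have haE W (y : Hom W Y) (z : Hom W Z) : holds ((a ∘ y) @@ z) <-> c ∘ z = y.
  rewrite ha; split=> [[k]|<-].
    by rewrite pairing_comp comp_idl => /pairing_inj [<- <-].
  by exists z; rewrite pairing_comp comp_idl.
have hbE W (y : Hom W Y) (z : Hom W Z) :
    holds ((b ∘ y) @@ z) <-> c ∘ z = y /\ exists k : Hom W S, s ∘ k = z.
  rewrite hb; split=> [[k]|[<- [k <-]]].
    rewrite pairing_comp => /pairing_inj [e1 e2].
    by split; [rewrite -e2 comp_assoc|exists k].
  by exists k; rewrite pairing_comp comp_assoc.
have main (U' Q : C) (m' : Hom U' Y) (j : Hom Q Z) (t : Hom Q U') :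
    is_pullback c m' j t -> sub_le j s -> a ∘ m' = b ∘ m'.
  move=> [_ hQ] [l el]; apply: pow_ext => W u z.
  rewrite -!comp_assoc haE hbE; split=> [e|[] //]; split=> //.
  have [h [[eh _] _]] := hQ _ _ _ e.
  by exists (l ∘ h); rewrite comp_assoc el.
have eab : a = b by apply: (covers_ext hc); [exact: (main _ _ _ _ _ hP)|
  exact: (main _ _ _ _ _ hP')].
have : holds ((a ∘ c) @@ idm Z) by apply/haE; rewrite comp_idr.
by rewrite eab => /hbE [].
Qed.

Definition is_initial (I : C) : Prop := forall X : C, exists! h : Hom I X, True.

Lemma initial_unique (I X : C) (g h : Hom I X) : is_initial I -> g = h.
Proof. by move=> hI; have [k [_ uk]] := hI X; rewrite -(uk g) // -(uk h). Qed.

(** The initial object of a topos is strict, as multiplication by an object has a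
    right adjoint. *)
Lemma initial_strict (I W : C) (z : Hom W I) : is_initial I -> degenerate W.
Proof.
move=> hI X g h.
suff e : g ∘ pr2 I W = h ∘ pr2 I W.
  have := f_equal (fun k => k ∘ ⟨z, idm W⟩) e.
  by rewrite -!comp_assoc pairing_snd !comp_idr.
have [x hx] := app_curry (g ∘ pr2 I W); have [y hy] := app_curry (h ∘ pr2 I W).
have := hy _ (pr1 I W) (pr2 I W).
by rewrite (initial_unique y x hI) hx -!comp_assoc pairing_snd.
Qed.

(** A least subobject of any object is initial. *)
Lemma bottom_initial (I Y : C) (s : Hom I Y) : is_mono s ->
  (forall (T : C) (t : Hom T Y), is_mono t -> sub_le s t) -> is_initial I.
Proof.
move=> hs hb.
have sec T (t : Hom T I) : is_mono t -> exists k : Hom I T, t ∘ k = idm I.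
  move=> ht; have [k ek] := hb T (s ∘ t) (mono_comp hs ht).
  by exists k; apply: hs; rewrite comp_assoc comp_idr.
have dg X (g h : Hom I X) : g = h.
  have [T [t [ht et _]]] := equalizer_exists g h; have [k ek] := sec T t ht.
  by rewrite -(comp_idr g) -(comp_idr h) -ek !comp_assoc et.
move=> X; have [x _] := pow_point X.
have [T [t [t' hT]]] :=
  pullback_exists (@topos_finite_limits C) (x ∘ to_one I) (singleton X).
have [k _] := sec T t (pullback_mono hT (@singleton_mono X)).
by exists (t' ∘ k).
Qed.

End Subobjects.

Lemma complement_exists (E : Topos) (U Y : E) (m : Hom U Y) : is_boolean E -> is_mono m ->
  exists (V I : E) (n : Hom V Y) (p : Hom I U) (q : Hom I V),
    [/\ is_mono n, covers m n, is_pullback m n p q & is_initial I].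
Proof.
move=> hE hm; have [V [n [hn [hmeet hjoin]]]] := hE Y U m hm.
have [I [p [q hI]]] := pullback_exists (@topos_finite_limits E) m n.
exists V, I, n, p, q; split=> //.
- move=> S s hs h1 h2; apply: (hjoin S s hs h1 h2 Y (idm Y)).
  by move=> W a b; rewrite !comp_idl.
- have hs : is_mono (m ∘ p) by apply: (mono_comp hm (pullback_mono hI hn)).
  apply: (bottom_initial hs) => T t ht; apply: hmeet => //; first by exists p.
  by exists q; rewrite (proj1 hI).
Qed.

Lemma initial_disjoint (C : Topos) (U V Y I : C) (m : Hom U Y) (n : Hom V Y)
    (p : Hom I U) (q : Hom I V) :
  is_pullback m n p q -> is_initial I -> disjoint m n.
Proof.
move=> [_ hP] hI W u v e; have [k _] := hP W u v e.
exact: (initial_strict k).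
Qed.

(** * Adjunctions and universal arrows *)

Section Adjunctions.
Context (C D : Category).

Section OneAdjunction.
Context (L : Functor C D) (R : Functor D C) (adj : Adjunction L R).

Lemma to_right_pre (X X' : C) (Y : D) (g : Hom (L X) Y) (u : Hom X' X) :
  to_right adj (g ∘ fmap L u) = to_right adj g ∘ u.
Proof.
by have := to_right_natural adj u g (idm Y); rewrite fmap_id !comp_idl.
Qed.

Lemma to_right_post (X : C) (Y Y' : D) (g : Hom (L X) Y) (h : Hom Y Y') :
  to_right adj (h ∘ g) = fmap R h ∘ to_right adj g.
Proof.
by have := to_right_natural adj (idm X) g h; rewrite fmap_id !comp_idr.
Qed.

Lemma to_right_inj (X : C) (Y : D) (g h : Hom (L X) Y) :
  to_right adj g = to_right adj h -> g = h.
Proof. by move=> e; rewrite -(to_left_right adj g) e to_left_right. Qed.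

End OneAdjunction.

(** [s] is a universal arrow from [X] to the functor [R]. *)
Definition universal_arrow (R : Functor D C) (X : C) (S : D) (s : Hom X (R S)) : Prop :=
  forall (A : D) (x : Hom X (R A)), exists! g : Hom S A, fmap R g ∘ s = x.

Lemma universal_arrow_ext (R : Functor D C) (X : C) (S A : D) (s : Hom X (R S))
    (g h : Hom S A) :
  universal_arrow s -> fmap R g ∘ s = fmap R h ∘ s -> g = h.
Proof.
move=> hs e; have [k [_ uk]] := hs A (fmap R h ∘ s).
by rewrite -(uk g) // -(uk h).
Qed.

Lemma adjunction_universal_arrow (L : Functor C D) (R : Functor D C)
    (adj : Adjunction L R) (X : C) :
  universal_arrow (to_right adj (idm (L X))).
Proof.
move=> A x; exists (to_left adj x); split.
- by rewrite -to_right_post comp_idr to_right_left.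
- by move=> g <-; rewrite -to_right_post comp_idr to_left_right.
Qed.

Lemma left_adjoint_exists (R : Functor D C) :
  (forall X : C, exists (S : D) (s : Hom X (R S)), universal_arrow s) ->
  exists L : Functor C D, inhabited (Adjunction L R).
Proof.
move=> H.
pose S X := proj1_sig (constructive_indefinite_description _ (H X)).
have H' X : exists s : Hom X (R (S X)), universal_arrow s.
  exact: (proj2_sig (constructive_indefinite_description _ (H X))).
pose s X := proj1_sig (constructive_indefinite_description _ (H' X)).
have hs X : universal_arrow (s X).
  exact: (proj2_sig (constructive_indefinite_description _ (H' X))).
pose tr X A (x : Hom X (R A)) :=
  proj1_sig (constructive_indefinite_description _ (hs X A x)).
have htr X A (x : Hom X (R A)) : fmap R (tr X A x) ∘ s X = x.
  by rewrite /tr; case: constructive_indefinite_description => g [].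
pose Lmap X Y (u : Hom X Y) : Hom (S X) (S Y) := tr X (S Y) (s Y ∘ u).
have LmapE X Y (u : Hom X Y) : fmap R (Lmap X Y u) ∘ s X = s Y ∘ u by exact: htr.
have Lid X : Lmap X X (idm X) = idm (S X).
  by apply: (universal_arrow_ext (hs X)); rewrite LmapE fmap_id comp_idl comp_idr.
have Lcomp X Y Z (g : Hom Y Z) (u : Hom X Y) :
    Lmap X Z (g ∘ u) = Lmap Y Z g ∘ Lmap X Y u.
  apply: (universal_arrow_ext (hs X)).
  by rewrite LmapE fmap_comp -comp_assoc LmapE !comp_assoc LmapE.
pose L : Functor C D :=
  {| fobj := S; fmap := Lmap; fmap_id := Lid; fmap_comp := Lcomp |}.
exists L; constructor.
refine {| to_right := fun X Y (g : Hom (L X) Y) => fmap R g ∘ s X;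
          to_left := fun X Y (x : Hom X (R Y)) => tr X Y x : Hom (L X) Y |}.
- by move=> X Y g; apply: (universal_arrow_ext (hs X)); rewrite htr.
- by move=> X Y x; rewrite htr.
- move=> X X' Y Y' u g h.
  by rewrite !fmap_comp -!comp_assoc; congr comp; congr comp; exact: LmapE.
Qed.

End Adjunctions.

(** * Lex functors *)

Section Lex.
Context (E F : Topos) (G : Functor E F) (hG : preserves_finite_limits G).

Lemma lex_product (X Y P : E) (p : Hom P X) (q : Hom P Y) :
  is_product p q -> is_product (fmap G p) (fmap G q).
Proof.
move=> hP.
have h1 := @one_terminal E.
have := lex_pullback hG (pullback_of_product (to_one X) (to_one Y) h1 hP).
exact: (product_of_pullback (lex_terminal hG h1)).
Qed.

Lemma lex_mono (X Y : E) (m : Hom X Y) : is_mono m -> is_mono (fmap G m).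
Proof.
move=> hm.
have hP : is_pullback m m (idm X) (idm X).
  split=> // W u v /hm ->; exists v; split; first by rewrite comp_idl.
  by move=> h [<- _]; rewrite comp_idl.
move=> W u v e; have [_ hP'] := lex_pullback hG hP.
by have [h [[]]] := hP' W u v e; rewrite fmap_id !comp_idl => <- <-.
Qed.

Lemma lex_equalizer (X Y S : E) (g h : Hom X Y) (e : Hom S X) :
  is_mono e -> g ∘ e = h ∘ e ->
  (forall (W : E) (x : Hom W X), g ∘ x = h ∘ x -> exists k : Hom W S, e ∘ k = x) ->
  forall (W : F) (x : Hom W (G X)), fmap G g ∘ x = fmap G h ∘ x ->
    exists k : Hom W (G S), fmap G e ∘ k = x.
Proof.
move=> he eq ue W x ex.
have hP : is_pullback ⟨idm X, g⟩ ⟨idm X, h⟩ e e.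
  split; first by rewrite !pairing_comp eq.
  move=> V u v; rewrite !pairing_comp !comp_idl => /pairing_inj [<- e1].
  have [k ek] := ue V u e1; exists k; split=> // k' [ek' _].
  by apply: he; rewrite ek ek'.
have [_ hP'] := lex_pullback hG hP.
have [|k [[ek _] _]] := hP' W x x; last by exists k.
by apply: (product_ext (lex_product (prod_product X Y)));
  rewrite !comp_assoc -!fmap_comp ?pairing_fst ?pairing_snd.
Qed.

End Lex.

(** * The left adjoint of a cartesian closed inverse image functor *)

Section CartesianClosed.
Context (E F : Topos) (f : GeometricMorphism F E).
Let G : Functor E F := inverse_image f.
Let adj : Adjunction G (direct_image f) := geom_adjunction f.
Let hG : preserves_finite_limits G := @inverse_image_lex F E f.

(** An arrow that is universal with respect to power objects is universal. Since
    each object [A] embeds into Pow A by the singleton map, uniqueness holds for all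
    targets, in particular for Omega. A morphism into Pow A factors through [A] if its
    composite with the characteristic morphism of the singleton map is constantly
    true, which can be checked after inverse image and composition with [s], by
    uniqueness for Omega. *)
Lemma universal_arrow_of_pow (X : F) (S : E) (s : Hom X (G S)) :
  (forall (B : E) (y : Hom X (G (Pow B))), exists! g : Hom S (Pow B), fmap G g ∘ s = y) ->
  universal_arrow s.
Proof.
move=> hs.
have uniq A (g h : Hom S A) : fmap G g ∘ s = fmap G h ∘ s -> g = h.
  move=> e; apply: (@singleton_mono E).
  have [k [_ uk]] := hs A (fmap G (singleton A ∘ g) ∘ s).
  rewrite -(uk (singleton A ∘ g)) //; apply: uk.
  by rewrite !fmap_comp -!comp_assoc e.
move=> A x.
have [y [ey _]] := hs A (fmap G (singleton A) ∘ x).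
have [chi hchi] := classify (@singleton_mono E A).
have hP := pullback_true (@singleton_mono E A) hchi.
have hy : chi ∘ y = true_point ∘ to_one S.
  apply: uniq; rewrite !fmap_comp -!comp_assoc ey comp_assoc -fmap_comp (proj1 hP).
  rewrite fmap_comp -comp_assoc; congr comp.
  have [k [_ uk]] := lex_terminal hG (@one_terminal E) X.
  by rewrite -(uk (_ ∘ x)) // -(uk (_ ∘ s)).
have [g [[eg _] _]] := proj2 hP S y (to_one S) hy.
have ex : fmap G g ∘ s = x.
  by apply: (lex_mono hG (@singleton_mono E A)); rewrite comp_assoc -fmap_comp eg.
by exists g; split=> // h eh; apply: uniq; rewrite eh.
Qed.

Context (hexp : preserves_exponentials G).

Let ex (A B : E) :
  is_exponential (fmap G (exp_pr1 A B)) (fmap G (exp_pr2 A B)) (fmap G (exp_ev A B)) :=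
  hexp (exp_exponential A B).

(** The inverse image functor commutes with evaluation. *)
Lemma inverse_image_app (A B W : E) (x : Hom W (exp A B)) (a : Hom W A) :
  fmap G (x @@ a) = apply_exp (ex A B) (fmap G x) (fmap G a).
Proof.
rewrite /apply_exp fmap_comp; congr comp.
by apply: (product_ext (proj1 (ex A B)));
  rewrite -!fmap_comp ?pairing_fst ?pairing_snd.
Qed.

Lemma inverse_image_pow_map (A B : E) (t : Hom A B) (W : F) (y : Hom W (G (Pow B)))
    (a : Hom W (G A)) :
  apply_exp (ex A Omega) (fmap G (pow_map t) ∘ y) a =
  apply_exp (ex B Omega) y (fmap G t ∘ a).
Proof.
pose hP := lex_product hG (prod_product (Pow B) A).
have := f_equal (fmap G) (pow_mapE t (pr1 (Pow B) A) (pr2 (Pow B) A)).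
rewrite !inverse_image_app => /(f_equal (fun k => k ∘ pairing hP y a)).
by rewrite !apply_exp_comp !fmap_comp -!comp_assoc pairing_fst pairing_snd.
Qed.

(** The functor sending [B] to the set of morphisms X -> f^* (Pow B) is represented
    by [T], the direct image of the exponential of the inverse image of Omega by X. *)
Lemma universal_relation (X : F) :
  exists (T : E) (theta : Hom X (G (Pow T))),
  forall (B : E) (y : Hom X (G (Pow B))),
    exists! t : Hom B T, fmap G (pow_map t) ∘ theta = y.
Proof.
pose EX : F := exp X (G Omega).
pose T := direct_image f EX.
pose eps : Hom (G T) EX := to_left adj (idm T).
have heps B (t : Hom B T) (u : Hom (G B) EX) :
    eps ∘ fmap G t = u <-> t = to_right adj u.
  have e : to_right adj (eps ∘ fmap G t) = t.
    by rewrite to_right_pre to_right_left comp_idl.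
  split=> [<- //|et]; apply: (to_right_inj (adj := adj)); by rewrite e.
have [theta htheta] := exp_curry (ex T Omega)
  ((eps ∘ pr2 X (G T)) @@ pr1 X (G T)) (prod_product X (G T)).
have hth W (x : Hom W X) (b : Hom W (G T)) :
    apply_exp (ex T Omega) (theta ∘ x) b = (eps ∘ b) @@ x.
  have := f_equal (fun k => k ∘ ⟨x, b⟩) htheta.
  by rewrite !apply_exp_comp -!comp_assoc pairing_fst pairing_snd.
exists T, theta => B y.
have [u hu] := app_curry
  (apply_exp (ex B Omega) (y ∘ pr2 (G B) X) (pr1 (G B) X)).
have hu' W (b : Hom W (G B)) (x : Hom W X) :
    (u ∘ b) @@ x = apply_exp (ex B Omega) (y ∘ x) b.
  by rewrite hu apply_exp_comp -comp_assoc pairing_fst pairing_snd.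
exists (to_right adj u); split.
- apply: (exp_ext (hE := ex B Omega) (prod_product X (G B))).
  rewrite -comp_assoc inverse_image_pow_map hth comp_assoc.
  by rewrite (proj2 (heps _ _ u) eq_refl) hu'.
- move=> t et; symmetry; apply/heps; apply: app_ext => V b x.
  by rewrite hu' -et -!comp_assoc inverse_image_pow_map hth.
Qed.

(** Let theta : X -> f^* (Pow T) be the universal relation. The object f_! X is the
    equalizer in Pow T of [eta (Pow T)] and of the structure map of the algebra [T] for
    the double power object monad; [theta] factors through the inverse image of this
    equalizer by the definition of the structure map. *)
Lemma universal_arrow_exists (X : F) :
  exists (S : E) (s : Hom X (G S)), universal_arrow s.
Proof.
have [T [theta hT]] := universal_relation X.
have hTu B (t t' : Hom B T) :
    fmap G (pow_map t) ∘ theta = fmap G (pow_map t') ∘ theta -> t = t'.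
  move=> e; have [k [_ uk]] := hT B (fmap G (pow_map t') ∘ theta).
  by rewrite -(uk t) // -(uk t').
have [alpha [halpha _]] := hT _ (fmap G (eta (Pow T)) ∘ theta).
have [S [e [he ee ue]]] := equalizer_exists (pow_map alpha) (eta (Pow T)).
have [s es] := lex_equalizer hG he ee ue halpha.
exists S, s; apply: universal_arrow_of_pow => B y.
have [t [et _]] := hT B y.
(* By injectivity of Pow B every morphism S -> Pow B extends to Pow T. The extension
   is the transpose of some c : B -> Pow (Pow T), and on S it coincides with
   [pow_map (alpha ∘ c)]. *)
have ext (g : Hom S (Pow B)) : exists c : Hom B (Pow (Pow T)),
    g = pow_map (alpha ∘ c) ∘ e /\ fmap G g ∘ s = fmap G (pow_map (alpha ∘ c)) ∘ theta.
  have [h [eh _]] := pow_injective g he; have [c ec] := pow_transpose h.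
  have eg : g = pow_map (alpha ∘ c) ∘ e.
    by rewrite pow_map_comp -comp_assoc ee comp_assoc -ec.
  by exists c; split=> //; rewrite {1}eg fmap_comp -comp_assoc es.
exists (pow_map t ∘ e); split; first by rewrite fmap_comp -comp_assoc es.
move=> g eg; have [c [eg' ec]] := ext g.
by rewrite eg'; congr (pow_map _ ∘ _); apply: hTu; rewrite -ec et eg.
Qed.

(** Frobenius reciprocity for products: if [s] exhibits [S] as f_! X, then S × A
    is f_! (X × f^* A). *)
Lemma universal_arrow_prod (X : F) (S A : E) (s : Hom X (G S)) :
  universal_arrow s ->
  universal_arrow (pairing (lex_product hG (prod_product S A))
    (s ∘ pr1 X (G A)) (pr2 X (G A))).
Proof.
move=> hs B x.
set c := pairing _ _ _.
have hc (g : Hom S (exp A B)) :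
    apply_exp (ex A B) ((fmap G g ∘ s) ∘ pr1 X (G A)) (pr2 X (G A)) =
    fmap G ((g ∘ pr1 S A) @@ pr2 S A) ∘ c.
  rewrite inverse_image_app apply_exp_comp fmap_comp -!comp_assoc.
  by rewrite pairing_fst pairing_snd.
have [y hy] := exp_curry (ex A B) x (prod_product X (G A)).
have [g [eg ug]] := hs _ y.
exists ((g ∘ pr1 S A) @@ pr2 S A); split; first by rewrite -hc eg hy.
move=> h eh; have [h' hh'] := app_curry h.
have hE : (h' ∘ pr1 S A) @@ pr2 S A = h.
  rewrite hh' -[RHS]comp_idr; congr comp.
  by apply: (product_ext (prod_product S A));
    rewrite comp_idr ?pairing_fst ?pairing_snd.
rewrite -hE (ug h') //.
by apply: (exp_ext (hE := ex A B) (prod_product X (G A))); rewrite hc hE eh.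
Qed.

(** Universal arrows restrict along complemented subobjects Q of Y: morphisms from Q,
    or from its pullback P, to a power object extend to Y, or to Z, by a constant on
    the complement. *)
Lemma universal_arrow_restrict (hE : is_boolean E) (Y Q : E) (m : Hom Q Y) (Z P : F)
    (c : Hom Z (G Y)) (i : Hom P Z) (r : Hom P (G Q)) :
  is_mono m -> universal_arrow c -> is_pullback c (fmap G m) i r -> universal_arrow r.
Proof.
move=> hm hc hP.
have [Q' [I [n [p [q [hn hcov hI hI0]]]]]] := complement_exists hE hm.
have hdisj := initial_disjoint hI hI0.
have [P' [i' [r' hP']]] := pullback_exists (@topos_finite_limits F) c (fmap G n).
(* As a left adjoint, f^* preserves the coproduct Y of Q and Q', hence the covering,
   and the initial object. As it preserves pullbacks, it also preserves disjointness. *)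
have hcovG : covers (fmap G m) (fmap G n).
  move=> S s hs [k1 e1] [k2 e2].
  have [k [ek1 ek2]] := covers_glue (to_right adj k1) (to_right adj k2) hm hn hcov hdisj.
  exists (to_left adj k); apply: (to_right_inj (adj := adj)).
  rewrite to_right_post to_right_left.
  apply: (covers_ext hcov); rewrite -comp_assoc -[RHS]to_right_pre comp_idl.
    by rewrite ek1 -to_right_post e1.
  by rewrite ek2 -to_right_post e2.
have hIG : is_initial (G I).
  move=> B; have [h [_ uh]] := hI0 (direct_image f B).
  exists (to_left adj h); split=> // k _.
  by rewrite (uh (to_right adj k)) // to_left_right.
have hcovF : covers i i' := covers_pullback hcovG hP hP'.
have hdisjF : disjoint i i'.
  have hd := initial_disjoint (lex_pullback hG hI) hIG.
  move=> W u v e; apply: (hd W (r ∘ u) (r' ∘ v)).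
  by rewrite !comp_assoc -(proj1 hP) -(proj1 hP') -!comp_assoc e.
apply: universal_arrow_of_pow => B y.
have [b _] := pow_point B.
pose cst : Hom Q' (Pow B) := b ∘ to_one Q'.
have [v [ev ev']] := covers_glue y (fmap G cst ∘ r')
  (pullback_mono hP (lex_mono hG hm)) (pullback_mono hP' (lex_mono hG hn)) hcovF hdisjF.
have [g [eg ug]] := hc _ v.
exists (g ∘ m); split.
  by rewrite fmap_comp -comp_assoc -(proj1 hP) comp_assoc eg.
move=> h eh; have [h' [eh1 eh2]] := covers_glue h cst hm hn hcov hdisj.
rewrite (ug h') //; apply: (covers_ext hcovF).
- by rewrite -comp_assoc (proj1 hP) comp_assoc -fmap_comp eh1 eh ev.
- by rewrite -comp_assoc (proj1 hP') comp_assoc -fmap_comp eh2 ev'.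
Qed.

End CartesianClosed.

Theorem theorem5p10 (E : Topos) (hE : is_boolean E) : is_CILC E.
Proof.
move=> F f hexp.
have [L [adj]] := left_adjoint_exists (universal_arrow_exists hexp).
exists {| shriek := L; shriek_adjunction := adj |} => /=.
move=> A B a X x P p1 p2 Q q1 q2 hP hQ.
set G := inverse_image f in adj hexp x p2 hP hQ *.
pose s X0 := to_right adj (idm (L X0)).
have hs X0 : universal_arrow (s X0) := @adjunction_universal_arrow _ _ _ _ adj X0.
have sE X0 A0 (g : Hom (L X0) A0) : fmap G g ∘ s X0 = to_right adj g.
  by rewrite -to_right_post comp_idr.
pose hG : preserves_finite_limits G := @inverse_image_lex F E f.
pose hSA := lex_product hG (prod_product (L X) A).
pose c := pairing hSA (s X ∘ pr1 X (G A)) (pr2 X (G A)).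
have hc : universal_arrow c := universal_arrow_prod hexp (hs X).
(* The fibre product Q is a subobject of f_! X × A, and P is the pullback of f^* Q
   along X × f^* A -> f^* (f_! X × A), so P -> f^* Q is a universal arrow. *)
pose m := ⟨q1, q2⟩.
have hm : is_mono m.
  by move=> W u v; rewrite !pairing_comp => /pairing_inj []; exact: (pullback_ext hQ).
have hGQ := lex_pullback hG hQ.
have hx : fmap G (to_left adj x) ∘ s X = x by rewrite sE to_right_left.
have [|r [[er1 er2] _]] := proj2 hGQ P (s X ∘ p1) p2.
  by rewrite comp_assoc hx (proj1 hP).
have Gm1 : fmap G (pr1 (L X) A) ∘ fmap G m = fmap G q1 by rewrite -fmap_comp pairing_fst.
have Gm2 : fmap G (pr2 (L X) A) ∘ fmap G m = fmap G q2 by rewrite -fmap_comp pairing_snd.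
have hR : is_pullback c (fmap G m) ⟨p1, p2⟩ r.
  split.
    apply: (product_ext hSA); rewrite !comp_assoc ?Gm1 ?Gm2 ?er1 ?er2.
      by rewrite pairing_fst -comp_assoc pairing_fst.
    by rewrite !pairing_snd.
  move=> W u v e.
  have e1 : s X ∘ (pr1 X (G A) ∘ u) = fmap G q1 ∘ v.
    by rewrite -Gm1 -comp_assoc -e !comp_assoc pairing_fst.
  have e2 : pr2 X (G A) ∘ u = fmap G q2 ∘ v.
    by rewrite -Gm2 -comp_assoc -e !comp_assoc pairing_snd.
  have [|h [[eh1 eh2] uh]] := proj2 hP W (pr1 X (G A) ∘ u) (pr2 X (G A) ∘ u).
    by rewrite -{1}hx -comp_assoc e1 e2 !comp_assoc (proj1 hGQ).
  exists h; split.
    split; first by rewrite pairing_comp eh1 eh2 pairing_eta.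
    apply: (pullback_ext hGQ); first by rewrite comp_assoc er1 -comp_assoc eh1 e1.
    by rewrite comp_assoc er2 eh2 e2.
  move=> k [eu _]; apply: uh.
  by rewrite -eu !comp_assoc pairing_fst pairing_snd.
have hr : universal_arrow r := universal_arrow_restrict hE hm hc hR.
pose k := to_left adj r.
have ek : fmap G k ∘ s P = r by rewrite sE to_right_left.
exists k; split.
  split; apply: (universal_arrow_ext (hs P)); rewrite fmap_comp -comp_assoc ek.
    by rewrite er1 sE -[fmap L p1]comp_idl to_right_pre.
  by rewrite er2 sE to_right_left.
have [k' [ek' _]] := hr _ (s P).
exists k'; split.
  by apply: (universal_arrow_ext (hs P)); rewrite fmap_comp -comp_assoc ek ek' fmap_id comp_idl.
by apply: (universal_arrow_ext hr); rewrite fmap_comp -comp_assoc ek' ek fmap_id comp_idl.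
Qed.
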